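(* Let $\mathbb{P}=(\mathcal{G},(\mathcal{D},\sqsubseteq),\delta)$ be a pattern setup. Then $$\mathbb{P}^{\blacktriangledown}=\big(\mathcal{G},(\wp(\mathcal{D}),\subseteq),\ \delta^{\blacktriangledown}:g\mapsto\{d\in\mathcal{D}\mid d\sqsubseteq\delta(g)\}\big)$$ is a pattern structure, with extent operator $ext^{\blacktriangledown}(S)=\bigcap_{d\in S}ext(d)$ for all $S\subseteq\mathcal{D}$, intent operator $int^{\blacktriangledown}(A)=cov(A)$ for all $A\subseteq\mathcal{G}$, and set of definable sets $\mathbb{P}^{\blacktriangledown}_{ext}=\{\bigcap\mathcal{S}\mid\mathcal{S}\subseteq\mathbb{P}_{ext}\}$ (with $\bigcap\emptyset=\mathcal{G}$).
   Context: A pattern setup is a triple $(\mathcal{G},(\mathcal{D},\sqsubseteq),\delta)$ with $\mathcal{G}$ a set, $(\mathcal{D},\sqsubseteq)$ a poset and $\delta:\mathcal{G}\to\mathcal{D}$ a map. Its extent operator is $ext(d)=\{g\in\mathcal{G}\mid d\sqsubseteq\delta(g)\}$, its definable sets $\mathbb{P}_{ext}=\{ext(d)\mid d\in\mathcal{D}\}$, and $cov(A)=\{d\in\mathcal{D}\mid\forall g\in A,\ d\sqsubseteq\delta(g)\}$. A pattern setup is a pattern structure if every subset of $\{\delta(g)\mid g\in\mathcal{G}\}$ (including $\emptyset$) has a meet in the description poset; its intent operator sends $A\subseteq\mathcal{G}$ to the meet of $\{\delta(g)\mid g\in A\}$. For $\mathbb{P}^{\blacktriangledown}$ the extent of $S\subseteq\mathcal{D}$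 is $\{g\mid S\subseteq\delta^{\blacktriangledown}(g)\}$. *)

(* Defs.v *)
From mathcomp Require Import all_boot all_order.
From mathcomp Require Import boolp classical_sets.

Set Implicit Arguments.
Unset Strict Implicit.
Unset Printing Implicit Defensive.

Local Open Scope classical_set_scope.

Record pattern_setup (disp : Order.disp_t) := PatternSetup {
  objects : Type;
  descriptions : porderType disp;
  delta : objects -> descriptions
}.

Arguments delta {disp} P g : rename.

Section PatternSetup.
Context {disp : Order.disp_t}.
Implicit Type P : pattern_setup disp.

Definition ext P (d : descriptions P) : set (objects P) :=
  [set g | (d <= delta P g)%O].

Definition definable_sets P : set (set (objects P)) := range (@ext P).

Definition cov P (A : set (objects P)) : set (descriptions P) :=
  [set d | forall g, A g -> (d <= delta P g)%O].

(* [S] may be empty, in which case its meet is a greatest description. *)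
Definition is_pattern_structure P : Prop :=
  forall S : set (descriptions P), S `<=` range (delta P) -> infimums S !=set0.

(* The meet of [delta P @` A]; [infimums] is a subsingleton by antisymmetry,
   so the choice made by [cid] is forced. *)
Definition intent P (HP : is_pattern_structure P) (A : set (objects P)) :
    descriptions P :=
  projT1 (cid (HP (delta P @` A) (image_subset (@subsetT _ A)))).

(* The order on [set T] is inclusion, see [subsetEset]. *)
Definition direct_completion P : pattern_setup set_display :=
  @PatternSetup set_display (objects P) (set (descriptions P))
    (fun g => [set d | (d <= delta P g)%O]).

End PatternSetup.

Arguments ext {disp} P d.
Arguments definable_sets {disp} P.
Arguments cov {disp} P A.
Arguments intent {disp P} HP A.

(* Main.v *)
Require Import Defs.
From mathcomp Require Import all_boot all_order.
From mathcomp Require Import boolp classical_sets.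

Local Open Scope classical_set_scope.

(** In a powerset ordered by inclusion every family has a meet, its intersection, so the completion
    is a pattern structure whatever [delta] is. The inclusion of [S] in the down-set of [delta P g]
    is tested one description at a time, which turns extents into intersections; intersecting the
    down-sets of [delta P g] over [g] in [A] leaves exactly [cov P A]. Definable sets then match
    because sets of descriptions and families of extents correspond through image and preimage under
    [ext P]. *)

Lemma bigcap_infimum {T : Type} (F : set (set T)) :
  infimums F (\bigcap_(X in F) X).
Proof.
split=> [X FX|Y lbY]; rewrite subsetEset; first exact: bigcap_inf.
by apply: sub_bigcap => X FX; rewrite -subsetEset; exact: lbY.
Qed.

(** Identifies the meet that [cid] picks inside [intent], of which only the infimum property is
    known. *)
Lemma infimum_bigcap {T : Type} (F : set (set T)) (Y : set T) :
  infimums F Y -> Y = \bigcap_(X in F) X.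
Proof.
by move=> infY; exact: is_subset1_infimums infY (bigcap_infimum F).
Qed.

Section DirectCompletion.
Context {disp : Order.disp_t} (P : pattern_setup disp).

Lemma direct_completion_is_pattern_structure :
  is_pattern_structure (direct_completion P).
Proof. by move=> S _; exists (\bigcap_(X in S) X); exact: bigcap_infimum. Qed.

Lemma ext_direct_completion (S : set (descriptions P)) :
  ext (direct_completion P) S = \bigcap_(d in S) ext P d.
(* Once the order is read as inclusion, both sides unfold to the same predicate on [g]. *)
Proof. by rewrite /ext /=; under eq_fun do rewrite subsetEset. Qed.

Lemma intent_direct_completion (H : is_pattern_structure (direct_completion P))
    (A : set (objects P)) : intent H A = cov P A.
Proof.
rewrite /intent; case: cid => /= Y /infimum_bigcap ->.
by rewrite bigcap_image.
Qed.

Lemma definable_sets_direct_completion :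
  definable_sets (direct_completion P) =
    [set \bigcap_(X in F) X |
       F in [set F : set (set (objects P)) | F `<=` definable_sets P]].
Proof.
apply/seteqP; split=> [_ [S _ <-]|_ [F /= FP <-]].
  exists (ext P @` S); first by move=> _ [d _ <-]; exists d.
  by rewrite bigcap_image ext_direct_completion.
(* Taking all descriptions with extent in [F] avoids choosing one per member; since [F] lies in the
   range of [ext P], the image of this preimage is [F] again. *)
exists (ext P @^-1` F) => //.
rewrite ext_direct_completion -(bigcap_image _ _ id); congr bigcap.
apply/seteqP; split=> [|X FX]; first exact: image_preimage_subset.
by have [d _ dX] := FP X FX; exists d; rewrite //= dX.
Qed.

End DirectCompletion.

Theorem theorem8p7 (disp : Order.disp_t) (P : pattern_setup disp) :
  exists H : is_pattern_structure (direct_completion P),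
    [/\ forall S : set (descriptions P),
          ext (direct_completion P) S = \bigcap_(d in S) ext P d,
        forall A : set (objects P),
          intent H A = cov P A
      & definable_sets (direct_completion P) =
          [set \bigcap_(X in F) X |
             F in [set F : set (set (objects P)) | F `<=` definable_sets P]]].
Proof.
exists (direct_completion_is_pattern_structure P); split.
- exact: ext_direct_completion.
- exact: intent_direct_completion.
- exact: definable_sets_direct_completion.
Qed.
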